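(* Let $B,Z,K$ be complex numbers with $K\ne0$ and $B\notin\{-1,-2,-3,\dots\}$, and let $(v_n)_{n\ge0}$ satisfy $(n+B)v_{n+1}=Znv_n+K(B-n)v_{n-1}$ for all $n\ge1$. Then for all $n\ge0$, $$v_{n+1}=\frac{P_n(B,Z,K)}{(B+1)_n}v_1+\frac{Q_n(B,Z,K)}{(B+1)_n}v_0,$$ where, with $\Lambda_i=\Lambda_i(B)=(B-i)_i(B)_i=\prod_{m=-i}^{i-1}(B+m)$, $$P_n=\sum_{j=0}^{\lfloor n/2\rfloor}(-1)^jK^{n-j}(Z/K)^{n-2j}\frac{(n-j)!}{(n-2j)!}\sum_{i=0}^{j}\frac{(-1)^i(n-i)!}{i!^2(j-i)!}\Lambda_i,$$ $$Q_n=(B-1)\sum_{j=0}^{\lfloor(n-1)/2\rfloor}(-1)^jK^{n-j}(Z/K)^{n-2j-1}\frac{(n-j-1)!}{(n-2j-1)!}\sum_{i=0}^{j}\frac{(-1)^i(n-i)!}{i!(i+1)!(j-i)!}\Lambda_i.$$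
   Context: $(a)_n=a(a+1)\cdots(a+n-1)$ denotes the rising Pochhammer symbol, with $(a)_0=1$; an empty sum is $0$. *)

(* Defs.v *)
From mathcomp Require Import all_boot all_order all_algebra.

Set Implicit Arguments.
Unset Strict Implicit.
Unset Printing Implicit Defensive.

Import GRing.Theory.
Local Open Scope ring_scope.

Definition pochhammer (F : fieldType) (a : F) (n : nat) : F :=
  \prod_(k < n) (a + k%:R).

Definition Lambda (F : fieldType) (B : F) (i : nat) : F :=
  pochhammer (B - i%:R) i * pochhammer B i.

(* The product of B + m over the integers -i <= m <= i - 1, with m = k - i. *)
Lemma Lambda_prod (F : fieldType) (B : F) (i : nat) :
  Lambda B i = \prod_(k < i + i) (B + (k%:Z - i%:Z)%:~R).
Proof.
rewrite /Lambda /pochhammer big_split_ord /=; congr (_ * _).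
  by apply: eq_bigr => k _; rewrite rmorphB /= -!pmulrn addrAC addrA.
by apply: eq_bigr => k _; rewrite PoszD addrAC subrr add0r -pmulrn.
Qed.

(* All natural-number subtractions below are exact on the summation ranges. *)
Definition Ppoly (F : fieldType) (B Z K : F) (n : nat) : F :=
  \sum_(j < (n./2).+1)
    (-1) ^+ j * K ^+ (n - j) * (Z / K) ^+ (n - 2 * j)
    * ((n - j)`!%:R / (n - 2 * j)`!%:R)
    * \sum_(i < j.+1)
        (-1) ^+ i * (n - i)`!%:R / (i`!%:R ^+ 2 * (j - i)`!%:R) * Lambda B i.

(* The range 0 <= j <= floor((n - 1) / 2) is j < (n.+1)./2, which is empty for
   n = 0, where the floor is -1. *)
Definition Qpoly (F : fieldType) (B Z K : F) (n : nat) : F :=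
  (B - 1) *
  \sum_(j < (n.+1)./2)
    (-1) ^+ j * K ^+ (n - j) * (Z / K) ^+ (n - 2 * j - 1)
    * ((n - j - 1)`!%:R / (n - 2 * j - 1)`!%:R)
    * \sum_(i < j.+1)
        (-1) ^+ i * (n - i)`!%:R / (i`!%:R * (i.+1)`!%:R * (j - i)`!%:R)
        * Lambda B i.

(* Main.v *)
(** After multiplication by [(B + 1)_n] the recurrence becomes
    [w_n = Z n w_(n-1) + K (B - n) (B + n - 1) w_(n-2)].  Both coefficient
    sequences are instances, for [e = 0] and [e = 1], of one family of sums.
    Comparing the coefficients of the powers of [Z], and expanding
    [(B - n) (B + n - 1) Lambda_i = Lambda_(i+1) - (n - i - 1) (n + i) Lambda_i],
    the recurrence for this family reduces to the polynomial identity
    [(n - j - e) (n - i) = n (n - 2 j - e) + i (i + e) + (n + i) (j - i)]. *)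
Require Import Defs.
From mathcomp Require Import all_boot all_order all_algebra.
From mathcomp Require Import reals complex.
From mathcomp Require Import ring zify.

Set Implicit Arguments.
Unset Strict Implicit.
Unset Printing Implicit Defensive.

Import GRing.Theory.
Local Open Scope ring_scope.

Lemma pochhammerS (F : fieldType) (a : F) (n : nat) :
  pochhammer a n.+1 = pochhammer a n * (a + n%:R).
Proof. by rewrite /pochhammer big_ord_recr. Qed.

Lemma pochhammerSl (F : fieldType) (a : F) (n : nat) :
  pochhammer a n.+1 = a * pochhammer (a + 1) n.
Proof.
rewrite /pochhammer big_ord_recl addr0; congr (_ * _).
by apply: eq_bigr => i _; rewrite /= /bump /= natrD addrA.
Qed.

(** Passing from [i] to [i + 1] adds to the product the two end factors [m = -i-1] and [m = i]. *)
Lemma LambdaS (F : fieldType) (B : F) (i : nat) :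
  Lambda B i.+1 = (B - i%:R - 1) * (B + i%:R) * Lambda B i.
Proof.
rewrite /Lambda pochhammerSl pochhammerS -natr1.
have -> : B - (i%:R + 1) + 1 = B - i%:R by ring.
ring.
Qed.

Section CoefficientFamily.

Variables (F : numFieldType) (B Z K : F) (e : nat).

Lemma factr_neq0 (n : nat) : n`!%:R != 0 :> F.
Proof. by rewrite Num.Theory.pnatr_eq0 -lt0n fact_gt0. Qed.

Definition inner_coef (m j i : nat) : F :=
  (-1) ^+ i * (m + e - i)`!%:R / (i`!%:R * (i + e)`!%:R * (j - i)`!%:R).

Definition inner_sum (m j : nat) : F :=
  \sum_(i < j.+1) inner_coef m j i * Lambda B i.

(* The index [m] is [n - e] for [n] as in [Ppoly] and [Qpoly].
   The falling factorial [(m - j) ^_ j] is [(m - j)! / (m - 2 j)!], but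
   vanishes for [m < 2 j], so that the summation range need not stop at
   [m / 2]. *)
Definition outer_sum (m : nat) : F :=
  \sum_(j < m.+1) (- K) ^+ j * Z ^+ (m - 2 * j) * ((m - j) ^_ j)%:R
    * inner_sum m j.

(** With [n = m + e + 2], this compares the coefficients of [Lambda_(k+1)] in [inner_sum_rec]: on
    the right, [Lambda_(k+1)] arises from the terms [k] and [k + 1] of [inner_sum m j]. *)
Lemma inner_coef_step (m j k : nat) : (k < j)%N -> (2 * j <= m)%N ->
  (m%:R - j%:R + 1) * inner_coef m.+2 j.+1 k.+1
    - (m%:R + e%:R + 2) * (m%:R - 2 * j%:R) * inner_coef m.+1 j.+1 k.+1
  = (m%:R + e%:R - k%:R) * (m%:R + e%:R + 3 + k%:R) * inner_coef m j k.+1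
    - inner_coef m j k.
Proof.
move=> kj jm.
(* Writing [j = k + t + 1] and [m = 2 j + s] makes every subtraction exact; [p] stays opaque so that
   [p!] is an atom for [field]. *)
have [t jE] : exists t, j = (k + t).+1 by exists (j - k.+1)%N; lia.
have [s mE] : exists s, m = (2 * (k + t).+1 + s)%N by exists (m - 2 * j)%N; lia.
have [p pN] : exists p, p = (k + 2 * t + s + e).+1 by eexists.
rewrite /inner_coef (_ : m.+2 + e - k.+1 = p.+2)%N; last lia.
rewrite (_ : m.+1 + e - k.+1 = p.+1)%N; last lia.
rewrite (_ : m + e - k = p.+1)%N; last lia.
rewrite (_ : m + e - k.+1 = p)%N; last lia.
rewrite (_ : j.+1 - k.+1 = t.+1)%N; last lia.
rewrite (_ : j - k = t.+1)%N; last lia.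
rewrite (_ : j - k.+1 = t)%N; last lia.
have pE : p%:R = k%:R + 2 * t%:R + s%:R + e%:R + 1 :> F.
  by rewrite pN; ring.
have mR : m%:R = 2 * (k%:R + t%:R + 1) + s%:R :> F.
  by rewrite mE; ring.
have jR : j%:R = k%:R + t%:R + 1 :> F by rewrite jE; ring.
rewrite addSn !factS !natrM -!natr1 natrD pE mR jR exprS.
have k1 : k%:R + 1 != 0 :> F by rewrite natr1 Num.Theory.pnatr_eq0.
have t1 : t%:R + 1 != 0 :> F by rewrite natr1 Num.Theory.pnatr_eq0.
have ke1 : k%:R + e%:R + 1 != 0 :> F.
  by rewrite -natrD natr1 Num.Theory.pnatr_eq0.
have := factr_neq0 k; have := factr_neq0 (k + e); have := factr_neq0 t.
move=> t0 ke0 k0.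
field.
by rewrite t0 ke0 k0 k1 t1 ke1.
Qed.

(** Coefficient of [Lambda_0], to which no lower term contributes. *)
Lemma inner_coef_first (m j : nat) :
  (m%:R - j%:R + 1) * inner_coef m.+2 j.+1 0
    - (m%:R + e%:R + 2) * (m%:R - 2 * j%:R) * inner_coef m.+1 j.+1 0
  = (m%:R + e%:R + 1) * (m%:R + e%:R + 2) * inner_coef m j 0.
Proof.
rewrite /inner_coef !subn0 add0n !addSn !factS !natrM -!natr1 natrD.
have j1 : j%:R + 1 != 0 :> F by rewrite natr1 Num.Theory.pnatr_eq0.
have := factr_neq0 j; have := factr_neq0 e => e0 j0.
by field; rewrite e0 j0 j1.
Qed.

(** Coefficient of the top [Lambda_(j+1)], which on the right comes only from raising [Lambda_j]. *)
Lemma inner_coef_last (m j : nat) : (2 * j <= m)%N ->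
  (m%:R - j%:R + 1) * inner_coef m.+2 j.+1 j.+1
    - (m%:R + e%:R + 2) * (m%:R - 2 * j%:R) * inner_coef m.+1 j.+1 j.+1
  = - inner_coef m j j.
Proof.
move=> jm; have [p pN] : exists p, p = (m + e - j)%N by eexists.
have pE : p%:R = m%:R + e%:R - j%:R :> F.
  by rewrite pN natrB ?natrD //; lia.
rewrite /inner_coef !subnn (_ : m.+2 + e - j.+1 = p.+1)%N; last lia.
rewrite (_ : m.+1 + e - j.+1 = p)%N; last lia.
rewrite -pN addSn !factS !natrM -!natr1 natrD pE exprS.
have j1 : j%:R + 1 != 0 :> F by rewrite natr1 Num.Theory.pnatr_eq0.
have je1 : j%:R + e%:R + 1 != 0 :> F.
  by rewrite -natrD natr1 Num.Theory.pnatr_eq0.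
have := factr_neq0 j; have := factr_neq0 (j + e) => je0 j0.
by field; rewrite je0 j0 j1 je1.
Qed.

(** The sums telescope: when [(B - n) (B + n - 1) Lambda_i] is expanded for all [i <= k], only the
    [Lambda_(k+1)] part of the last term survives. *)
Lemma inner_sum_partial (m j k : nat) : (k <= j)%N -> (2 * j <= m)%N ->
  \sum_(i < k.+1)
    ((m%:R - j%:R + 1) * inner_coef m.+2 j.+1 i
     - (m%:R + e%:R + 2) * (m%:R - 2 * j%:R) * inner_coef m.+1 j.+1 i)
    * Lambda B i
  + (B - (m%:R + e%:R + 2)) * (B + (m%:R + e%:R + 1))
    * \sum_(i < k.+1) inner_coef m j i * Lambda B i
  = inner_coef m j k * Lambda B k.+1.
Proof.
elim: k => [|k IH] kj jm.
  rewrite !big_ord1 inner_coef_first LambdaS; ring.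
rewrite big_ord_recr [in X in _ + X]big_ord_recr /=.
rewrite inner_coef_step // [X in _ + X]mulrDr addrACA (IH (ltnW kj) jm).
rewrite (LambdaS B k.+1); ring.
Qed.

Lemma inner_sum_rec (m j : nat) : (2 * j <= m)%N ->
  (m%:R - j%:R + 1) * inner_sum m.+2 j.+1
  = (m%:R + e%:R + 2) * (m%:R - 2 * j%:R) * inner_sum m.+1 j.+1
    - (B - (m%:R + e%:R + 2)) * (B + (m%:R + e%:R + 1)) * inner_sum m j.
Proof.
move=> jm; have := inner_sum_partial (leqnn j) jm; rewrite -/(inner_sum m j).
move/(canRL (addrK _)) => partialE.
have splitE : (m%:R - j%:R + 1) * inner_sum m.+2 j.+1
    - (m%:R + e%:R + 2) * (m%:R - 2 * j%:R) * inner_sum m.+1 j.+1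
  = \sum_(i < j.+2)
    ((m%:R - j%:R + 1) * inner_coef m.+2 j.+1 i
     - (m%:R + e%:R + 2) * (m%:R - 2 * j%:R) * inner_coef m.+1 j.+1 i)
    * Lambda B i.
  rewrite /inner_sum !mulr_sumr -sumrB; apply: eq_bigr => i _; ring.
(* The top term [i = j + 1] cancels the remainder of the telescoped sum. *)
move/(canRL (subrK _)): splitE => ->; rewrite big_ord_recr /= inner_coef_last // partialE; ring.
Qed.

Lemma inner_sum0 (m : nat) : (m + e)`!%:R / e`!%:R = inner_sum m 0.
Proof.
rewrite /inner_sum big_ord1 /inner_coef /Lambda /pochhammer !big_ord0.
by rewrite !subn0 add0n expr0 !mul1r !mulr1.
Qed.

Lemma outer_sum0 : outer_sum 0 = 1.
Proof.
rewrite /outer_sum big_ord1 -inner_sum0 /= add0n divff ?factr_neq0 //.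
by rewrite !expr0 ffactn0 !mulr1.
Qed.

Lemma outer_sum1 : outer_sum 1 = Z * (e%:R + 1).
Proof.
rewrite /outer_sum big_ord_recr big_ord1 /= mulr0n mulr0.
rewrite mul0r addr0 -inner_sum0 add1n factS natrM -natr1 mulfK ?factr_neq0 //.
by rewrite muln0 subn0 ffactn0 expr0 mul1r expr1 mulr1.
Qed.

(** Term [j + 1] on the left is matched with term [j + 1] of [outer_sum m.+1] and term [j] of
    [outer_sum m], which carry the same power of [Z]; [inner_sum_rec] then relates their inner
    sums. *)
Lemma outer_sum_rec (m : nat) :
  outer_sum m.+2 = Z * (m%:R + e%:R + 2) * outer_sum m.+1
    + K * (B - (m%:R + e%:R + 2)) * (B + (m%:R + e%:R + 1)) * outer_sum m.
Proof.
rewrite {1}/outer_sum big_ord_recr /= (_ : (m.+2 - m.+2) ^_ m.+2 = 0)%N; last first.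
  by rewrite ffact_small // subnn.
rewrite mulr0 mul0r addr0 /outer_sum big_ord_recl [in RHS]big_ord_recl.
rewrite mulrDr -[RHS]addrA; congr (_ + _).
  rewrite -!inner_sum0 /= !muln0 !subn0 !ffactn0 !expr0 addSn factS natrM.
  by rewrite (exprS _ m.+1); ring.
rewrite !mulr_sumr -big_split; apply: eq_bigr => -[j jm] _ /=.
rewrite /bump /= !add1n [(m.+2 - j.+1)%N]subSS [(m.+1 - j.+1)%N]subSS.
(* For [m < 2 j] all three falling factorials vanish. *)
have [j2m|m2j] := leqP (2 * j) m; last first.
  rewrite ![((m - j) ^_ _)%N]ffact_small ?ffactSS; try lia.
  rewrite [((m.+1 - j) ^_ _)%N]ffact_small; last by lia.
  by rewrite !(mulr0, mul0r, addr0).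
(* For [m = 2 j] the exponent on the left is truncated to 0, but the factor [m - 2 j] makes both
   sides vanish. *)
have ZE : Z * Z ^+ (m.+1 - 2 * j.+1) * (m - j - j)%:R
          = Z ^+ (m - 2 * j) * (m%:R - 2 * j%:R).
  rewrite -natrM -natrB // -subnDA addnn -mul2n.
  have [->|j2m'] := eqVneq (2 * j)%N m; first by rewrite subnn !mulr0.
  by rewrite -exprS; congr (_ ^+ _ * _); lia.
rewrite [(m.+1 - j)%N]subSn; last lia.
rewrite ffactSS ffactnSr !natrM -natr1 natrB; last lia.
rewrite (_ : m.+2 - 2 * j.+1 = m - 2 * j)%N; last lia.
have recE := congr1 (fun x =>
  (- K) ^+ j.+1 * Z ^+ (m - 2 * j) * ((m - j) ^_ j)%:R * x) (inner_sum_rec j2m).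
transitivity ((- K) ^+ j.+1 * Z ^+ (m - 2 * j) * ((m - j) ^_ j)%:R *
  ((m%:R - j%:R + 1) * inner_sum m.+2 j.+1)); first by ring.
rewrite recE exprS.
move: ZE; move: (Z ^+ (m.+1 - _)) (_ - _ - _)%:R => z d ZE.
transitivity (- K * (- K) ^+ j * ((m - j) ^_ j)%:R * (m%:R + e%:R + 2)
    * inner_sum m.+1 j.+1 * (Z ^+ (m - 2 * j) * (m%:R - 2 * j%:R))
  + K * (B - (m%:R + e%:R + 2)) * (B + (m%:R + e%:R + 1)) *
    ((- K) ^+ j * Z ^+ (m - 2 * j) * ((m - j) ^_ j)%:R * inner_sum m j)).
  by ring.
by rewrite -ZE; ring.
Qed.

(** Back to the shape of [Ppoly]: [K^(m-j) (Z/K)^(m-2j) = K^j Z^(m-2j)], and the terms with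
    [2 j > m] vanish. *)
Lemma outer_sum_half (m : nat) : K != 0 ->
  outer_sum m = \sum_(j < (m./2).+1)
    (-1) ^+ j * K ^+ (m - j) * (Z / K) ^+ (m - 2 * j)
    * ((m - j)`!%:R / (m - 2 * j)`!%:R) * inner_sum m j.
Proof.
move=> K0; have mm : ((m./2).+1 <= m.+1)%N by lia.
rewrite /outer_sum (big_ord_widen _ (fun j : nat =>
  (-1) ^+ j * K ^+ (m - j) * (Z / K) ^+ (m - 2 * j)
    * ((m - j)`!%:R / (m - 2 * j)`!%:R) * inner_sum m j) mm).
rewrite [RHS]big_mkcond /=; apply: eq_bigr => -[j jm] _ /=.
case: ifPn => j2; last by rewrite ffact_small ?mulr0 ?mul0r //; lia.
congr (_ * _); rewrite -(@ffact_fact (m - j) j); last lia.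
rewrite (_ : m - j - j = m - 2 * j)%N; last lia.
rewrite natrM mulfK ?factr_neq0 //; congr (_ * _).
rewrite (_ : m - j = j + (m - 2 * j))%N; last lia.
have KZ : K * (Z / K) = Z by rewrite mulrC divfK.
by rewrite -{1}KZ exprMn (exprNn K) exprD !mulrA.
Qed.

End CoefficientFamily.

Lemma Ppoly_outer_sum (F : numFieldType) (B Z K : F) (n : nat) : K != 0 ->
  Ppoly B Z K n = outer_sum B Z K 0 n.
Proof.
move=> K0; rewrite outer_sum_half //; apply: eq_bigr => j _; congr (_ * _).
by apply: eq_bigr => i _; rewrite /inner_coef !addn0 expr2.
Qed.

Lemma Qpoly0 (F : fieldType) (B Z K : F) : Qpoly B Z K 0 = 0.
Proof. by rewrite /Qpoly big_ord0 mulr0. Qed.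

(** The index drops by one because [e = 1]; the spare factor [K] comes from [K^(n+1-j)]. *)
Lemma QpolyS_outer_sum (F : numFieldType) (B Z K : F) (n : nat) : K != 0 ->
  Qpoly B Z K n.+1 = (B - 1) * K * outer_sum B Z K 1 n.
Proof.
move=> K0; rewrite outer_sum_half // -mulrA mulr_sumr; congr (_ * _).
apply: eq_bigr => -[j jn] _ /=.
rewrite (_ : n.+1 - j = (n - j).+1)%N; last lia.
rewrite (_ : n.+1 - 2 * j - 1 = n - 2 * j)%N; last lia.
rewrite subn1 /= exprS !mulrA [K * _]mulrC; congr (_ * _).
by apply: eq_bigr => i _; rewrite /inner_coef !addn1.
Qed.

Lemma Ppoly_rec (F : numFieldType) (B Z K : F) (n : nat) : K != 0 ->
  Ppoly B Z K n.+2 = Z * n.+2%:R * Ppoly B Z K n.+1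
    + K * (B - n.+2%:R) * (B + n.+1%:R) * Ppoly B Z K n.
Proof. by move=> K0; rewrite !Ppoly_outer_sum // outer_sum_rec; ring. Qed.

Lemma Qpoly_rec (F : numFieldType) (B Z K : F) (n : nat) : K != 0 ->
  Qpoly B Z K n.+2 = Z * n.+2%:R * Qpoly B Z K n.+1
    + K * (B - n.+2%:R) * (B + n.+1%:R) * Qpoly B Z K n.
Proof.
(* [Q_0 = 0] lies outside the family, so the step to [Q_2] is checked directly. *)
move=> K0; case: n => [|n]; rewrite !QpolyS_outer_sum //.
  by rewrite outer_sum1 outer_sum0 Qpoly0; ring.
by rewrite outer_sum_rec; ring.
Qed.

Theorem theorem8p1 (R : realType) (B Z K : R[i]) (v : nat -> R[i])
  (hK : K != 0)
  (hB : forall m : nat, (1 <= m)%N -> B != - m%:R)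
  (hv : forall n : nat, (1 <= n)%N ->
    (n%:R + B) * v n.+1 = Z * n%:R * v n + K * (B - n%:R) * v n.-1) :
  forall n : nat,
    v n.+1 = Ppoly B Z K n / pochhammer (B + 1) n * v 1%N
             + Qpoly B Z K n / pochhammer (B + 1) n * v 0%N.
Proof.
have B0 n : n.+1%:R + B != 0 by rewrite addrC addr_eq0 hB.
have poch0 n : pochhammer (B + 1) n != 0.
  elim: n => [|n IH]; first by rewrite /pochhammer big_ord0 oner_neq0.
  rewrite pochhammerS mulf_neq0 //.
  by rewrite (_ : B + 1 + n%:R = n.+1%:R + B) // -natr1; ring.
pose solved n := pochhammer (B + 1) n * v n.+1
  = Ppoly B Z K n * v 1%N + Qpoly B Z K n * v 0%N.
suff all_solved n : solved n.
  move=> n; apply: (mulfI (poch0 n)); rewrite all_solved; field.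
  exact: poch0.
(* The recurrence has order two, so two consecutive cases are carried along. *)
suff : solved n /\ solved n.+1 by case.
elim: n => [|n [IH0 IH1]].
  rewrite /solved !Ppoly_outer_sum // Qpoly0 QpolyS_outer_sum //.
  rewrite !outer_sum0 outer_sum1 pochhammerS /pochhammer big_ord0.
  split; first by ring.
  have := hv 1%N isT => /= hv1; rewrite mul1r addr0 (addrC B) hv1; ring.
split=> //; rewrite /solved Ppoly_rec // Qpoly_rec //.
have hvn := hv n.+2 isT.
transitivity (pochhammer (B + 1) n.+1 * ((n.+2%:R + B) * v n.+3)).
  by rewrite pochhammerS; ring.
rewrite hvn /=.
(* Splitting [(B + 1)_(n+1)] releases the factor [B + n + 1] of the recurrence for [P] and [Q]. *)
transitivity (Z * n.+2%:R * (pochhammer (B + 1) n.+1 * v n.+2)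
  + K * (B - n.+2%:R) * (B + n.+1%:R) * (pochhammer (B + 1) n * v n.+1)).
  by rewrite pochhammerS; ring.
by rewrite IH0 IH1; ring.
Qed.
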